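(* Let $m\geq 1$ be any odd integer. Then $$\sum_{n=1}^{\infty}(-1)^{n+1}H_n\sum_{j=0}^{m-1}\frac{(-1)^j}{2mn+2j+1}=\frac{(m+1)\pi}{4}\log 2-mG+\frac{\pi}{2}\sum_{k=0}^{\frac{m-3}{2}}\log\left(1+\sqrt{\frac{1-\varphi_k}{2}}\right),$$ where $\varphi_k=\cos\left(\frac{(2k+1)\pi}{m}\right)$.
   Context: $H_n=1+\frac12+\cdots+\frac1n$ is the $n$th harmonic number and $G=\sum_{n=0}^\infty \frac{(-1)^n}{(2n+1)^2}$ is the Catalan constant. An empty sum $\sum_{k=0}^{-1}(\cdot)$ is taken to be zero. *)

(* Defs.v *)
From Stdlib Require Import Reals.
From Coquelicot Require Import Coquelicot.
Open Scope R_scope.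

(* f 0 + ... + f (n-1).  The library's [sum_f_R0 f p] has p+1 terms, so it
   cannot express the empty sum. *)
Definition sum_lt (f : nat -> R) (n : nat) : R :=
  match n with
  | O => 0
  | S p => sum_f_R0 f p
  end.

Definition harmonic (n : nat) : R := sum_lt (fun k => / INR (k + 1)) n.

(* [Series] is a total operator; this series converges absolutely, so the value
   is the actual sum. *)
Definition catalan : R := Series (fun n => (-1) ^ n / (2 * INR n + 1) ^ 2).

Definition phi (m k : nat) : R := cos ((2 * INR k + 1) * PI / INR m).

(* General term of the series, meant for n >= 1. *)
Definition term (m n : nat) : R :=
  (-1) ^ (n + 1) * harmonic n *
  sum_lt (fun j => (-1) ^ j / (2 * INR m * INR n + 2 * INR j + 1)) m.

(* Main.v *)
Require Import Defs.
From Stdlib Require Import Reals Lra Lia.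
From Coquelicot Require Import Coquelicot.
Open Scope R_scope.

(* Put T = tan^(2m) t on [0, PI/4].  Since m is odd, the inner sum of the series
   is the integral of T^n (1 + T), so summation by parts identifies the series
   with the integral of ln (1 + T).  With w = tan^2 t, the factorization of
   1 + w^m over the roots of -1 gives
     ln (1 + T) = m (2 ln 2 - ln (2 + 2 cos 2t))
       + sum_k (2 ln ((1 + s_k) / 2) + ln (1 + 2 r_k cos 4t + r_k^2)),
   where s_k = sqrt ((1 - phi_k) / 2) and r_k = (1 - s_k) / (1 + s_k).  The
   Fourier expansion of ln (1 + 2 r cos v + r^2), with a remainder bound uniform
   up to r = 1, then shows that ln (2 + 2 cos 2t) integrates to G and that the
   terms in r_k integrate to 0. *)

(** * Finite sums and their termwise calculus *)

Lemma sum_lt_S (f : nat -> R) (n : nat) : sum_lt f (S n) = sum_lt f n + f n.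
Proof. destruct n as [|n]; simpl; lra. Qed.

Lemma sum_lt_ext (f g : nat -> R) (n : nat) :
  (forall k, (k < n)%nat -> f k = g k) -> sum_lt f n = sum_lt g n.
Proof.
  induction n as [|n IH]; intros H; [reflexivity|].
  rewrite !sum_lt_S, IH, H; auto with arith.
Qed.

Lemma sum_lt_scal (c : R) (f : nat -> R) (n : nat) :
  sum_lt (fun k => c * f k) n = c * sum_lt f n.
Proof.
  induction n as [|n IH]; [simpl; ring|].
  rewrite !sum_lt_S, IH; ring.
Qed.

Lemma sum_lt_plus_const (c : R) (f : nat -> R) (n : nat) :
  sum_lt (fun k => c + f k) n = INR n * c + sum_lt f n.
Proof.
  induction n as [|n IH]; [simpl; ring|].
  rewrite !sum_lt_S, IH, S_INR; ring.
Qed.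

Lemma sum_n_sum_lt (f : nat -> R) (n : nat) : sum_n f n = sum_lt f (S n).
Proof. now rewrite sum_n_Reals. Qed.

Lemma is_derive_sum_lt (f : nat -> R -> R) (df : nat -> R) (x : R) (n : nat) :
  (forall k, (k < n)%nat -> is_derive (f k) x (df k)) ->
  is_derive (fun y => sum_lt (fun k => f k y) n) x (sum_lt df n).
Proof.
  induction n as [|n IH]; intros H.
  - exact (is_derive_const (0 : R) x).
  - rewrite sum_lt_S.
    apply (is_derive_ext (fun y => sum_lt (fun k => f k y) n + f n y)).
    { intros t; now rewrite sum_lt_S. }
    apply (is_derive_plus (fun y => sum_lt (fun k => f k y) n) (f n));
      auto with arith.
Qed.

Lemma is_RInt_sum_lt (f : nat -> R -> R) (v : nat -> R) (a b : R) (n : nat) :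
  (forall k, (k < n)%nat -> is_RInt (f k) a b (v k)) ->
  is_RInt (fun t => sum_lt (fun k => f k t) n) a b (sum_lt v n).
Proof.
  induction n as [|n IH]; intros H.
  - replace (sum_lt v 0) with (scal (b - a) (0 : R)) by apply Rmult_0_r.
    apply (is_RInt_const a b (0 : R)).
  - rewrite sum_lt_S.
    apply (is_RInt_ext (fun t => sum_lt (fun k => f k t) n + f n t)).
    { intros t _; now rewrite sum_lt_S. }
    apply (is_RInt_plus (fun t => sum_lt (fun k => f k t) n) (f n));
      auto with arith.
Qed.

(** * A convergence criterion and a mean value estimate *)

(** This rate serves both limits below: the kernel error is O(1/n), while harmonic numbers, bounded
    by a multiple of sqrt n, cost a factor sqrt n. *)
Lemma is_lim_seq_le_inv_sqrt (u : nat -> R) (l K : R) :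
  (forall n, Rabs (u n - l) <= K / sqrt (INR (S n))) -> is_lim_seq u l.
Proof.
  intros H.
  apply (is_lim_seq_ext (fun n => (u n - l) + l)); [intros n; ring|].
  replace (Finite l) with (Finite (0 + l)) by (f_equal; ring).
  apply is_lim_seq_plus'; [|apply is_lim_seq_const].
  apply is_lim_seq_abs_0.
  apply (is_lim_seq_le_le (fun _ => 0) _ (fun n => K * / sqrt (INR (S n)))).
  - intros n; split; [apply Rabs_pos|apply H].
  - apply is_lim_seq_const.
  - replace (Finite 0) with (Rbar_mult K 0) by (simpl; f_equal; ring).
    apply is_lim_seq_scal_l.
    replace (Finite 0) with (Rbar_inv p_infty) by reflexivity.
    apply is_lim_seq_inv; [|discriminate].
    apply (filterlim_comp _ _ _ (fun n => INR (S n)) sqrt _ (Rbar_locally p_infty));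
      [|apply filterlim_sqrt_p].
    apply (is_lim_seq_incr_1 INR p_infty), is_lim_seq_INR.
Qed.

(** For e = 1 and e = -1, the function K x^(n+1) / (n+1) - e f(x) vanishes at 0 and has nonnegative
    derivative; the mean value theorem then bounds e f(r). *)
Lemma abs_derive_le_pow (f df : R -> R) (K r : R) (n : nat) :
  0 <= r -> f 0 = 0 ->
  (forall x, 0 <= x <= r -> is_derive f x (df x)) ->
  (forall x, 0 <= x <= r -> Rabs (df x) <= K * x ^ n) ->
  Rabs (f r) <= K * r ^ S n / INR (S n).
Proof.
  intros Hr H0 Hd Hb.
  assert (Hn : INR (S n) <> 0) by (apply not_0_INR; lia).
  assert (Hmain : forall e, Rabs e = 1 -> e * f r <= K * r ^ S n / INR (S n)).
  { intros e He.
    destruct (MVT_gen (fun x => K * x ^ S n / INR (S n) - e * f x) 0 r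
                (fun x => K * x ^ n - e * df x)) as [c [Hc Heq]].
    - intros x Hx. rewrite Rmin_left, Rmax_right in Hx by lra.
      apply (is_derive_minus (fun x => K * x ^ S n / INR (S n)) (fun x => e * f x)).
      + auto_derive; [trivial|].
        change (match n with O => 1 | S _ => INR n + 1 end) with (INR (S n)).
        field; exact Hn.
      + apply is_derive_scal, Hd; lra.
    - intros x Hx. rewrite Rmin_left, Rmax_right in Hx by lra.
      apply continuity_pt_filterlim.
      apply (continuous_minus (fun x => K * x ^ S n / INR (S n)) (fun x => e * f x)).
      + apply (ex_derive_continuous (fun x => K * x ^ S n / INR (S n))).
        auto_derive; trivial.
      + apply (ex_derive_continuous (fun x => e * f x)).
        exists (e * df x). apply is_derive_scal, Hd; lra.
    - rewrite Rmin_left, Rmax_right in Hc by lra.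
      rewrite H0, (pow_i (S n)) in Heq by lia.
      assert (0 <= K * c ^ n - e * df c).
      { specialize (Hb c Hc).
        assert (e * df c <= Rabs (e * df c)) by apply Rle_abs.
        rewrite Rabs_mult, He in H. lra. }
      assert (0 <= (K * c ^ n - e * df c) * (r - 0)) by (apply Rmult_le_pos; lra).
      rewrite <- Heq in H1. replace (K * 0 / INR (S n)) with 0 in H1 by (field; exact Hn).
      lra. }
  assert (H1 := Hmain 1 Rabs_R1).
  assert (H2 := Hmain (-1) ltac:(rewrite Rabs_left; lra)).
  apply Rabs_le; lra.
Qed.

(** * Fourier expansion of the logarithmic kernel *)

(** Partial Fourier sum of ln (1 + 2 r cos v + r^2) = 2 ln |1 + r e^(iv)|. *)
Definition log_kernel_partial (N : nat) (r v : R) : R :=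
  2 * sum_lt (fun k => (-1) ^ k * r ^ S k * cos (INR (S k) * v) / INR (S k)) N.

(** Real part of a geometric sum of ratio -r e^(iv), multiplied by |1 + r e^(iv)|^2. *)
Lemma cos_geometric_sum (N : nat) (r v : R) :
  (1 + 2 * r * cos v + r ^ 2) *
    sum_lt (fun k => (-1) ^ k * r ^ k * cos (INR (S k) * v)) N =
  cos v + r - (-1) ^ N * r ^ N * (cos (INR (S N) * v) + r * cos (INR N * v)).
Proof.
  induction N as [|N IH].
  - replace (INR 1 * v) with v by (simpl; ring).
    replace (INR 0 * v) with 0 by (simpl; ring).
    rewrite cos_0. simpl. ring.
  - rewrite sum_lt_S, Rmult_plus_distr_l, IH.
    assert (H : cos (INR (S (S N)) * v) = 2 * cos v * cos (INR (S N) * v) - cos (INR N * v)).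
    { rewrite (S_INR (S N)).
      replace (INR N * v) with (INR (S N) * v - v) by (rewrite S_INR; ring).
      replace ((INR (S N) + 1) * v) with (INR (S N) * v + v) by ring.
      rewrite cos_plus, cos_minus. ring. }
    rewrite H. simpl pow. ring.
Qed.

(* Differentiating in [r] turns the partial sum into a geometric sum, so the
   remainder has a closed-form derivative. *)
Lemma log_kernel_remainder (N : nat) (r v d : R) :
  0 <= r <= 1 -> 0 < d ->
  (forall x, 0 <= x <= r -> d <= 1 + 2 * x * cos v + x ^ 2) ->
  Rabs (ln (1 + 2 * r * cos v + r ^ 2) - log_kernel_partial N r v)
    <= 4 / d * r ^ S N / INR (S N).
Proof.
  intros Hr Hd Hden.
  apply (abs_derive_le_pow
    (fun x => ln (1 + 2 * x * cos v + x ^ 2) - log_kernel_partial N x v)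
    (fun x => 2 * ((-1) ^ N * x ^ N * (cos (INR (S N) * v) + x * cos (INR N * v)))
              / (1 + 2 * x * cos v + x ^ 2))); [lra| | |].
  - unfold log_kernel_partial.
    replace (1 + 2 * 0 * cos v + 0 ^ 2) with 1 by ring. rewrite ln_1.
    (* Zero terms are written [0 * 0] so that [sum_lt_scal] extracts a factor 0. *)
    rewrite (sum_lt_ext _ (fun k => 0 * 0)), sum_lt_scal; [ring|].
    intros k _. rewrite (pow_i (S k)) by lia. unfold Rdiv; ring.
  - intros x Hx. specialize (Hden x Hx).
    assert (Hp : 1 + 2 * x * cos v + x ^ 2 <> 0) by lra.
    replace (2 * _ / _) with
      ((2 * cos v + 2 * x) / (1 + 2 * x * cos v + x ^ 2) -
       2 * sum_lt (fun k => (-1) ^ k * x ^ k * cos (INR (S k) * v)) N).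
    + apply (is_derive_minus (fun x => ln (1 + 2 * x * cos v + x ^ 2))
               (fun x => log_kernel_partial N x v)).
      * auto_derive; [simpl in *; lra|field; exact Hp].
      * apply is_derive_scal.
        apply (is_derive_sum_lt
          (fun k x => (-1) ^ k * x ^ S k * cos (INR (S k) * v) / INR (S k))).
        intros k _. auto_derive; [trivial|].
        change (match k with O => 1 | S _ => INR k + 1 end) with (INR (S k)).
        field. apply not_0_INR; lia.
    + apply (Rmult_eq_reg_l (1 + 2 * x * cos v + x ^ 2)); [|exact Hp].
      assert (E := cos_geometric_sum N x v).
      transitivity (2 * cos v + 2 * x - 2 * ((1 + 2 * x * cos v + x ^ 2) * 
         sum_lt (fun k => (-1) ^ k * x ^ k * cos (INR (S k) * v)) N)).
      { field; exact Hp. }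
      rewrite E. field; exact Hp.
  - intros x Hx. specialize (Hden x Hx).
    rewrite Rabs_div by lra.
    rewrite (Rabs_pos_eq (1 + _ + _)) by lra.
    rewrite !Rabs_mult, pow_1_abs, (Rabs_pos_eq 2), (Rabs_pos_eq (x ^ N))
      by (try apply pow_le; lra).
    (* The constant 4 is the factor 2 of the kernel times this bound, valid as x <= 1. *)
    assert (Hc : Rabs (cos (INR (S N) * v) + x * cos (INR N * v)) <= 2).
    { assert (H1 := COS_bound (INR (S N) * v)). assert (H2 := COS_bound (INR N * v)).
      apply Rabs_le. nra. }
    assert (Hx0 : 0 <= x ^ N) by (apply pow_le; lra).
    apply Rle_trans with (4 * x ^ N / (1 + 2 * x * cos v + x ^ 2)).
    + apply Rmult_le_compat_r; [left; apply Rinv_0_lt_compat; lra|]. nra.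
    + replace (4 / d * x ^ N) with (4 * x ^ N / d) by (field; lra).
      apply Rmult_le_compat_l; [lra|]. apply Rinv_le_contravar; lra.
Qed.

Lemma is_RInt_log_kernel_partial (N : nat) (r q b : R) :
  q <> 0 ->
  is_RInt (fun t => log_kernel_partial N r (q * t)) 0 b
    (2 * sum_lt (fun k => (-1) ^ k * r ^ S k * sin (INR (S k) * (q * b))
                          / (INR (S k) * q) / INR (S k)) N).
Proof.
  intros Hq.
  apply (is_RInt_scal (fun t => sum_lt (fun k => (-1) ^ k * r ^ S k
     * cos (INR (S k) * (q * t)) / INR (S k)) N)).
  apply (is_RInt_sum_lt (fun k t => (-1) ^ k * r ^ S k
     * cos (INR (S k) * (q * t)) / INR (S k))).
  intros k _.
  assert (Hk : INR (S k) <> 0) by (apply not_0_INR; lia).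
  generalize dependent (INR (S k)). generalize ((-1) ^ k * r ^ S k).
  intros c n Hn.
  set (F := fun t => c * sin (n * (q * t)) / (n * q) / n).
  replace (_ / n) with (minus (F b) (F 0)).
  2: { unfold F, minus, plus, opp; simpl. rewrite !Rmult_0_r, sin_0. field; auto. }
  apply (is_RInt_derive F).
  - intros x _. unfold F. auto_derive; [trivial|]. field; auto.
  - intros x _. apply (ex_derive_continuous (V := R_NormedModule)). auto_derive; trivial.
Qed.

(** The bound [d] makes the remainder uniform in t, so the limit passes under the integral. It must
    hold for every x in [0, r] because the remainder is estimated along that segment; r = 1 stays
    allowed. *)
Lemma is_lim_seq_RInt_log_kernel (r q d b : R) :
  0 <= r <= 1 -> 0 < d -> q <> 0 -> 0 <= b ->
  (forall t x, 0 <= t <= b -> 0 <= x <= r -> d <= 1 + 2 * x * cos (q * t) + x ^ 2) ->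
  ex_RInt (fun t => ln (1 + 2 * r * cos (q * t) + r ^ 2)) 0 b /\
  is_lim_seq
    (fun N => 2 * sum_lt (fun k => (-1) ^ k * r ^ S k * sin (INR (S k) * (q * b))
                          / (INR (S k) * q) / INR (S k)) N)
    (RInt (fun t => ln (1 + 2 * r * cos (q * t) + r ^ 2)) 0 b).
Proof.
  intros Hr Hd Hq Hb Hden.
  assert (Hex : ex_RInt (fun t => ln (1 + 2 * r * cos (q * t) + r ^ 2)) 0 b).
  { apply (ex_RInt_continuous (V := R_CompleteNormedModule)). intros t Ht.
    rewrite Rmin_left, Rmax_right in Ht by lra.
    apply (ex_derive_continuous (V := R_NormedModule)). specialize (Hden t r Ht ltac:(lra)).
    auto_derive. simpl in *; lra. }
  split; [exact Hex|].
  apply (is_lim_seq_le_inv_sqrt _ _ (b * (4 / d))). intros N.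
  set (L := RInt _ _ _).
  assert (HL := RInt_correct _ _ _ Hex). fold L in HL.
  assert (HP := is_RInt_log_kernel_partial N r q b Hq).
  set (P := 2 * sum_lt _ N) in *.
  rewrite Rabs_minus_sym.
  assert (HD := is_RInt_minus _ _ _ _ _ _ HL HP).
  rewrite <- (is_RInt_unique _ _ _ _ HD : RInt _ 0 b = L - P).
  apply Rle_trans with ((b - 0) * (4 / d * / sqrt (INR (S N)))).
  2: { right. unfold Rdiv. ring. }
  apply abs_RInt_le_const; [exact Hb|now exists (L - P)|].
  intros t Ht.
  change (Rabs (ln (1 + 2 * r * cos (q * t) + r ^ 2) - log_kernel_partial N r (q * t))
    <= 4 / d * / sqrt (INR (S N))).
  eapply Rle_trans; [apply (log_kernel_remainder N r (q * t) d); auto|].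
  assert (Hd4 : 0 <= 4 / d) by (apply Rdiv_le_0_compat; lra).
  unfold Rdiv at 1. rewrite Rmult_assoc. apply Rmult_le_compat_l; [exact Hd4|].
  assert (H1 : 1 <= INR (S N)) by (rewrite S_INR; assert (H := pos_INR N); lra).
  assert (Hs : 1 <= sqrt (INR (S N))) by (rewrite <- sqrt_1; apply sqrt_le_1; lra).
  (* Here r^(N+1) <= 1, and 1/(N+1) is weakened to 1/sqrt (N+1). *)
  rewrite <- (Rmult_1_l (/ sqrt _)).
  apply Rmult_le_compat; [apply pow_le; lra|left; apply Rinv_0_lt_compat; lra| |].
  - rewrite <- (pow1 (S N)). apply pow_incr; lra.
  - apply Rinv_le_contravar; [lra|].
    rewrite <- (sqrt_sqrt (INR (S N))) at 2 by lra. nra.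
Qed.

(** * The two logarithmic integrals *)

Lemma sin_INR_PI (n : nat) : sin (INR n * PI) = 0.
Proof.
  induction n as [|n IH].
  - rewrite Rmult_0_l. apply sin_0.
  - replace (INR (S n) * PI) with (INR n * PI + PI) by (rewrite S_INR; ring).
    rewrite neg_sin, IH. ring.
Qed.

Lemma sin_odd_PI2 (j : nat) : sin ((2 * INR j + 1) * (PI / 2)) = (-1) ^ j.
Proof.
  induction j as [|j IH].
  - replace ((2 * INR 0 + 1) * (PI / 2)) with (PI / 2) by (simpl; ring).
    apply sin_PI2.
  - replace ((2 * INR (S j) + 1) * (PI / 2))
      with ((2 * INR j + 1) * (PI / 2) + PI) by (rewrite S_INR; field).
    rewrite neg_sin, IH. simpl. ring.
Qed.

(* The integral of [cos (k * 4t)] over [0, PI/4] vanishes for all k >= 1. *)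
Lemma is_RInt_log_poisson (r : R) :
  0 <= r < 1 ->
  is_RInt (fun t => ln (1 + 2 * r * cos (4 * t) + r ^ 2)) 0 (PI / 4) 0.
Proof.
  intros Hr. assert (Hpi := PI_RGT_0).
  (* The kernel is at least (1 - x)^2 >= (1 - r)^2, positive since r < 1. *)
  destruct (is_lim_seq_RInt_log_kernel r 4 ((1 - r) ^ 2) (PI / 4)) as [Hex Hlim];
    try lra.
  - apply pow_lt; lra.
  - intros t x _ Hx. assert (H := COS_bound (4 * t)).
    assert (0 <= 2 * x * (cos (4 * t) + 1)) by nra.
    assert ((1 - r) * (1 - r) <= (1 - x) * (1 - x)) by nra.
    nra.
  - assert (E : is_lim_seq (fun N => 0) (RInt (fun t => ln (1 + 2 * r * cos (4 * t) + r ^ 2)) 0 (PI / 4))).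
    { revert Hlim. apply is_lim_seq_ext. intros N.
      rewrite (sum_lt_ext _ (fun k => 0 * 0)), sum_lt_scal; [ring|].
      intros k _. replace (INR (S k) * (4 * (PI / 4))) with (INR (S k) * PI) by field.
      rewrite sin_INR_PI. unfold Rdiv; ring. }
    apply is_lim_seq_unique in E. rewrite Lim_seq_const in E.
    (* [E] equates extended reals, so the value 0 is displayed as the real part of one. *)
    change (is_RInt (fun t => ln (1 + 2 * r * cos (4 * t) + r ^ 2)) 0 (PI / 4) (real 0)).
    rewrite E.
    apply (RInt_correct (V := R_CompleteNormedModule)), Hex.
Qed.

(** This is the kernel at r = 1 and angle 2t. At t = PI/4 the primitive involves sin (k PI/2), which
    vanishes for even k and alternates for odd k, leaving the Catalan series. *)
Lemma is_RInt_log_catalan :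
  is_RInt (fun t => ln (2 + 2 * cos (2 * t))) 0 (PI / 4) catalan.
Proof.
  assert (Hpi := PI_RGT_0).
  (* The bound 1 holds because cos 2t >= 0 on [0, PI/4]. *)
  destruct (is_lim_seq_RInt_log_kernel 1 2 1 (PI / 4)) as [Hex Hlim]; try lra.
  - intros t x Ht Hx. assert (0 <= cos (2 * t)) by (apply cos_ge_0; lra).
    assert (0 <= x * cos (2 * t)) by (apply Rmult_le_pos; lra).
    nra.
  - set (L := RInt _ _ _) in Hlim.
    assert (HL : is_RInt (fun t => ln (1 + 2 * 1 * cos (2 * t) + 1 ^ 2)) 0 (PI / 4) L)
      by (apply (RInt_correct (V := R_CompleteNormedModule)), Hex).
    replace catalan with L.
    + revert HL. apply is_RInt_ext. intros t _. f_equal. ring.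
    + symmetry. apply is_series_unique.
      change (is_lim_seq (sum_n (fun n => (-1) ^ n / (2 * INR n + 1) ^ 2)) L).
      (* Two consecutive kernel terms make one Catalan term, and [sum_n] up to n has n+1 terms. *)
      apply (is_lim_seq_subseq _ _ (fun n => (2 * S n)%nat)) in Hlim.
      * revert Hlim. apply is_lim_seq_ext. intros N. rewrite sum_n_sum_lt.
        generalize (S N). clear. intros M.
        induction M as [|M IH]; [simpl; ring|].
        replace (2 * S M)%nat with (S (S (2 * M))) by lia.
        rewrite !sum_lt_S, !Rmult_plus_distr_l, IH, !pow1.
        replace (INR (S (S (2 * M))) * (2 * (PI / 4))) with (INR (S M) * PI)
          by (rewrite !S_INR, mult_INR; simpl; field).
        rewrite sin_INR_PI.
        replace (INR (S (2 * M)) * (2 * (PI / 4))) with ((2 * INR M + 1) * (PI / 2))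
          by (rewrite !S_INR, mult_INR; simpl; field).
        rewrite sin_odd_PI2, pow_1_even, !S_INR, mult_INR.
        assert (HM := pos_INR M). simpl. field. lra.
      * apply eventually_subseq. intros n; lia.
Qed.

(** * Products, monic polynomials and the factorization of 1 + w^m *)

Fixpoint prod_lt (f : nat -> R) (n : nat) : R :=
  match n with
  | O => 1
  | S p => prod_lt f p * f p
  end.

Lemma prod_lt_pos (f : nat -> R) (n : nat) :
  (forall k, (k < n)%nat -> 0 < f k) -> 0 < prod_lt f n.
Proof.
  induction n as [|n IH]; intros H; simpl; [lra|].
  apply Rmult_lt_0_compat; auto with arith.
Qed.

Lemma ln_prod_lt (f : nat -> R) (n : nat) :
  (forall k, (k < n)%nat -> 0 < f k) ->
  ln (prod_lt f n) = sum_lt (fun k => ln (f k)) n.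
Proof.
  induction n as [|n IH]; intros H; [apply ln_1|].
  rewrite sum_lt_S. simpl. rewrite ln_mult, IH; auto with arith.
  apply prod_lt_pos; auto with arith.
Qed.

Lemma prod_lt_scal (c : R) (f : nat -> R) (n : nat) :
  prod_lt (fun k => c * f k) n = c ^ n * prod_lt f n.
Proof. induction n as [|n IH]; simpl; [ring|]. rewrite IH. ring. Qed.

(* Horner form lets us divide by [z - a] without handling coefficients. *)
Fixpoint monic (d : nat) (f : R -> R) : Prop :=
  match d with
  | O => forall z, f z = 1
  | S d' => exists c g, monic d' g /\ forall z, f z = c + z * g z
  end.

Lemma monic_sub (e d : nat) (f g : R -> R) :
  (d < e)%nat -> monic e f -> monic d g -> monic e (fun z => f z - g z).
Proof.
  revert d f g. induction e as [|e IH]; intros d f g Hde Hf Hg; [lia|].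
  destruct Hf as (c & f' & Hf' & Hf). destruct d as [|d].
  - exists (c - 1), f'. split; [exact Hf'|].
    intros z. rewrite Hf, Hg. ring.
  - destruct Hg as (c' & g' & Hg' & Hg).
    exists (c - c'), (fun z => f' z - g' z).
    split; [apply (IH d); auto with arith|].
    intros z. rewrite Hf, Hg. ring.
Qed.

(** Synthetic division: f = c + z g and g = g(a) + (z - a) h give the quotient g(a) + z h. *)
Lemma monic_divide (d : nat) (f : R -> R) (a : R) :
  monic (S d) f -> exists g, monic d g /\ forall z, f z = f a + (z - a) * g z.
Proof.
  revert f. induction d as [|d IH]; intros f (c & g & Hg & Hf).
  - exists (fun _ => 1). split; [easy|].
    intros z. rewrite !Hf, !Hg. ring.
  - destruct (IH g Hg) as (h & Hh & Hgh).
    exists (fun z => g a + z * h z). split; [now exists (g a), h|].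
    intros z. rewrite !Hf, (Hgh z). ring.
Qed.

(** Splitting off the last root leaves a quotient that vanishes at the others, since they are
    distinct from it. *)
Lemma monic_eq_prod_roots (d : nat) (f : R -> R) (r : nat -> R) (z : R) :
  monic d f -> (forall k, (k < d)%nat -> f (r k) = 0) ->
  (forall i j, (i < j < d)%nat -> r i <> r j) ->
  f z = prod_lt (fun k => z - r k) d.
Proof.
  revert f. induction d as [|d IH]; intros f Hf Hroot Hinj; [apply Hf|].
  destruct (monic_divide d f (r d) Hf) as (g & Hg & Hfg).
  rewrite (Hroot d) in Hfg by lia. simpl.
  rewrite Hfg, <- (IH g Hg); [ring| |].
  - intros k Hk. assert (H := Hfg (r k)). rewrite Hroot in H by lia.
    assert (r k - r d <> 0) by (assert (Hn := Hinj k d); apply Rminus_eq_contra, Hn; lia).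
    apply (Rmult_eq_reg_l (r k - r d)); [lra|assumption].
  - intros i j Hij. apply Hinj; lia.
Qed.

(* In terms of [z = w + /w], this is [(w^(2d+1) + 1) / (w^d (w + 1))]. *)
Fixpoint airfoil (d : nat) (z : R) : R :=
  match d with
  | O => 1
  | S d' => match d' with
            | O => z - 1
            | S d'' => z * airfoil d' z - airfoil d'' z
            end
  end.

Lemma airfoil_SS (d : nat) (z : R) :
  airfoil (S (S d)) z = z * airfoil (S d) z - airfoil d z.
Proof. reflexivity. Qed.

Lemma nat_ind_SS (P : nat -> Prop) :
  P 0%nat -> P 1%nat -> (forall n, P n -> P (S n) -> P (S (S n))) -> forall n, P n.
Proof.
  intros H0 H1 H n. enough (P n /\ P (S n)) by tauto.
  induction n as [|n [IH1 IH2]]; auto.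
Qed.

Lemma monic_airfoil (d : nat) : monic d (airfoil d).
Proof.
  induction d as [| |d IH0 IH1] using nat_ind_SS.
  - easy.
  - exists (-1), (fun _ => 1). split; [easy|]. intros z; simpl; ring.
  - apply (monic_sub (S (S d)) d (fun z => z * airfoil (S d) z)); [lia| |exact IH0].
    exists 0, (airfoil (S d)). split; [exact IH1|]. intros z; ring.
Qed.

(** The Chebyshev polynomial of the third kind at z/2, with the denominator cos b cleared; its zeros
    can be read off the right side. *)
Lemma airfoil_cos (d : nat) (b : R) :
  airfoil d (2 * cos (2 * b)) * cos b = cos ((2 * INR d + 1) * b).
Proof.
  induction d as [| |d IH0 IH1] using nat_ind_SS.
  - simpl. rewrite Rmult_1_l. f_equal. ring.
  - replace ((2 * INR 1 + 1) * b) with (2 * b + b) by (simpl; ring).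
    rewrite cos_plus, sin_2a, cos_2a. simpl.
    assert (H := sin2_cos2 b). unfold Rsqr in H.
    apply Rminus_diag_uniq.
    transitivity (cos b * (sin b * sin b + cos b * cos b - 1)); [ring|rewrite H; ring].
  - rewrite airfoil_SS.
    replace ((2 * INR (S (S d)) + 1) * b) with ((2 * INR (S d) + 1) * b + 2 * b)
      by (rewrite !S_INR; ring).
    replace ((2 * INR d + 1) * b) with ((2 * INR (S d) + 1) * b - 2 * b) in IH0
      by (rewrite !S_INR; ring).
    rewrite cos_minus in IH0. rewrite cos_plus.
    rewrite Rmult_minus_distr_r, IH0, Rmult_assoc, IH1. ring.
Qed.

(** Both sides satisfy u_(d+2) = (w^2 + 1) u_(d+1) - w^2 u_d. *)
Lemma airfoil_joukowski (d : nat) (w : R) :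
  w <> 0 -> w ^ d * (w + 1) * airfoil d (w + / w) = w ^ (2 * d + 1) + 1.
Proof.
  intros Hw. induction d as [| |d IH0 IH1] using nat_ind_SS.
  - simpl. ring.
  - simpl. field. exact Hw.
  - replace (2 * S (S d) + 1)%nat with (4 + (2 * d + 1))%nat by lia.
    replace (2 * S d + 1)%nat with (2 + (2 * d + 1))%nat in IH1 by lia.
    rewrite airfoil_SS, Rmult_minus_distr_l.
    transitivity ((w ^ 2 + 1) * (w ^ S d * (w + 1) * airfoil (S d) (w + / w))
                  - w ^ 2 * (w ^ d * (w + 1) * airfoil d (w + / w))).
    + simpl. field. exact Hw.
    + rewrite IH0, IH1, !pow_add. ring.
Qed.

(** On (0, PI) cosine is injective, which separates the roots, and the half-angles have positive
    cosine. *)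
Lemma phi_angle_bounds (d k : nat) :
  (k < d)%nat -> 0 < (2 * INR k + 1) * PI / INR (2 * d + 1) < PI.
Proof.
  intros Hk. apply lt_INR in Hk.
  assert (Hpi := PI_RGT_0). assert (H := pos_INR k).
  rewrite plus_INR, mult_INR. simpl INR. split.
  - apply Rdiv_lt_0_compat; nra.
  - apply (Rmult_lt_reg_r (2 * INR d + 1)); [lra|].
    replace (_ / _ * _) with ((2 * INR k + 1) * PI) by (field; lra). nra.
Qed.

(** Each quadratic belongs to a conjugate pair of m-th roots of -1, and 1 + w to the real root. In z
    = w + 1/w the pairs become the zeros 2 [phi] of [airfoil]. *)
Lemma one_plus_pow_odd_factor (d : nat) (w : R) :
  0 < w ->
  1 + w ^ (2 * d + 1) =
  (1 + w) * prod_lt (fun k => w ^ 2 - 2 * phi (2 * d + 1) k * w + 1) d.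
Proof.
  intros Hw. assert (Hpi := PI_RGT_0).
  set (m := (2 * d + 1)%nat).
  assert (Hm : INR m = 2 * INR d + 1) by (unfold m; rewrite plus_INR, mult_INR; simpl; ring).
  assert (Hm0 : 0 < INR m) by (rewrite Hm; assert (H := pos_INR d); lra).
  assert (Hlt := phi_angle_bounds d). fold m in Hlt.
  assert (E : airfoil d (w + / w) = prod_lt (fun k => (w + / w) - 2 * phi m k) d).
  { apply (monic_eq_prod_roots d (airfoil d) (fun k => 2 * phi m k)).
    - apply monic_airfoil.
    - intros k Hk. unfold phi. specialize (Hlt k Hk).
      set (a := (2 * INR k + 1) * PI / INR m) in *.
      assert (Hc : 0 < cos (a / 2)) by (apply cos_gt_0; lra).
      (* With b = a/2, the angle (2d+1) b is k PI + PI/2, where cosine vanishes. *)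
      assert (H := airfoil_cos d (a / 2)).
      replace (2 * (a / 2)) with a in H by field.
      replace ((2 * INR d + 1) * (a / 2)) with (INR k * PI + PI / 2) in H
        by (rewrite <- Hm; unfold a; field; lra).
      rewrite cos_plus, sin_INR_PI, cos_PI2 in H.
      apply (Rmult_eq_reg_r (cos (a / 2))); lra.
    - intros i j Hij. unfold phi.
      assert (Hi := Hlt i ltac:(lia)). assert (Hj := Hlt j ltac:(lia)).
      assert (cos ((2 * INR j + 1) * PI / INR m) < cos ((2 * INR i + 1) * PI / INR m));
        [|lra].
      apply cos_decreasing_1; try lra.
      apply Rmult_lt_compat_r; [now apply Rinv_0_lt_compat|].
      apply Rmult_lt_compat_r; [exact Hpi|].
      assert (INR i < INR j) by (apply lt_INR; lia). lra. }
  assert (F := airfoil_joukowski d w ltac:(lra)). fold m in F.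
  rewrite Rplus_comm, <- F, E.
  transitivity ((w + 1) * (w ^ d * prod_lt (fun k => (w + / w) - 2 * phi m k) d)); [ring|].
  (* The power w^d supplies one w to each factor, clearing its 1/w. *)
  rewrite <- prod_lt_scal, (Rplus_comm w 1). f_equal.
  (* Detaching [m] from [d] keeps the angles fixed while the number of factors varies. *)
  generalize m. clear - Hw. intros m. induction d as [|d IH]; [reflexivity|]. cbn [prod_lt].
  rewrite IH. f_equal. field. lra.
Qed.

Lemma phi_lt_1 (d k : nat) : (k < d)%nat -> phi (2 * d + 1) k < 1.
Proof.
  intros Hk. destruct (phi_angle_bounds d k Hk). rewrite <- cos_0.
  apply cos_decreasing_1; lra.
Qed.

(** * Closed form and integral of ln (1 + tan^(2m) t) *)

(** For c = cos a with a in (0, PI), the root is s = sin (a/2); these bounds put r = (1 - s) / (1 +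
    s) in [0, 1). *)
Lemma half_angle_sine_bounds (c : R) :
  -1 <= c < 1 -> 0 < sqrt ((1 - c) / 2) <= 1.
Proof.
  intros Hc. split; [apply sqrt_lt_R0; lra|].
  rewrite <- sqrt_1 at 2. apply sqrt_le_1; lra.
Qed.

(** With u = cos 2t, tan^2 t = (1 - u) / (1 + u), and clearing (1 + u)^2 leaves 4 s^2 + 4 (1 - s^2)
    u^2. As 2 u^2 = 1 + cos 4t, this equals (1 + s)^2 (1 + 2 r cos 4t + r^2) with r = (1 - s) / (1 +
    s). *)
Lemma quadratic_tan_factor (t c s : R) :
  0 < t < PI / 4 -> 0 < s -> s ^ 2 = (1 - c) / 2 ->
  (tan t ^ 2) ^ 2 - 2 * c * tan t ^ 2 + 1 =
  (4 / (2 + 2 * cos (2 * t))) ^ 2 *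
  (((1 + s) / 2) ^ 2 *
   (1 + 2 * ((1 - s) / (1 + s)) * cos (4 * t) + ((1 - s) / (1 + s)) ^ 2)).
Proof.
  intros Ht Hs Hc. assert (Hpi := PI_RGT_0).
  assert (Hcos : 0 < cos t) by (apply cos_gt_0; lra).
  replace (4 * t) with (2 * (2 * t)) by ring.
  rewrite (cos_2a_cos (2 * t)), (cos_2a_cos t). unfold tan.
  replace c with (1 - 2 * s ^ 2) by lra.
  assert (E : sin t ^ 2 = 1 - cos t ^ 2)
    by (assert (H := sin2_cos2 t); unfold Rsqr in H; simpl; lra).
  unfold Rdiv at 1 2. rewrite Rpow_mult_distr, E.
  field. repeat split; try lra. nra.
Qed.

(** The quantity q = 1 + tan^2 t = 4 / (2 + 2 cos 2t) occurs once in the linear factor and squared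
    in each of the d quadratics, hence m = 2d + 1 times. *)
Lemma ln_one_plus_tan_pow (d : nat) (t : R) :
  let m := (2 * d + 1)%nat in
  let s k := sqrt ((1 - phi m k) / 2) in
  let r k := (1 - s k) / (1 + s k) in
  0 < t < PI / 4 ->
  ln (1 + tan t ^ (2 * m)) =
  INR m * (2 * ln 2 - ln (2 + 2 * cos (2 * t))) +
  sum_lt (fun k => 2 * ln ((1 + s k) / 2) + ln (1 + 2 * r k * cos (4 * t) + r k ^ 2)) d.
Proof.
  intros m s r Ht. assert (Hpi := PI_RGT_0).
  assert (Htan : 0 < tan t) by (apply tan_gt_0; lra).
  assert (Hw : 0 < tan t ^ 2) by (apply pow_lt; exact Htan).
  assert (Hcos : 0 < cos t) by (apply cos_gt_0; lra).
  assert (Hcos2 : 0 < cos (2 * t)) by (apply cos_gt_0; lra).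
  set (q := 4 / (2 + 2 * cos (2 * t))).
  assert (Hq : 0 < q) by (apply Rdiv_lt_0_compat; lra).
  assert (Hlnq : ln q = 2 * ln 2 - ln (2 + 2 * cos (2 * t))).
  { unfold q. rewrite ln_div by lra. replace 4 with (2 * 2) by ring.
    rewrite ln_mult by lra. ring. }
  assert (Hq1 : 1 + tan t ^ 2 = q).
  { unfold q. rewrite cos_2a_cos. unfold tan, Rdiv at 1. rewrite Rpow_mult_distr.
    replace (sin t ^ 2) with (1 - cos t ^ 2)
      by (assert (H := sin2_cos2 t); unfold Rsqr in H; simpl; lra).
    field. split; [nra|lra]. }
  assert (Hs : forall k, (k < d)%nat -> 0 < s k <= 1).
  { intros k Hk. apply half_angle_sine_bounds.
    split; [apply COS_bound|now apply phi_lt_1]. }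
  set (g := fun k => ((1 + s k) / 2) ^ 2 * (1 + 2 * r k * cos (4 * t) + r k ^ 2)).
  assert (Hr : forall k, (k < d)%nat -> 0 < 1 + 2 * r k * cos (4 * t) + r k ^ 2).
  { intros k Hk. specialize (Hs k Hk).
    assert (0 <= r k) by (apply Rdiv_le_0_compat; lra).
    assert (r k < 1).
    { unfold r. apply (Rmult_lt_reg_r (1 + s k)); [lra|].
      replace ((1 - s k) / (1 + s k) * (1 + s k)) with (1 - s k) by (field; lra). lra. }
    assert (H1 := COS_bound (4 * t)).
    assert (0 < (1 - r k) * (1 - r k)) by nra. nra. }
  assert (Hg : forall k, (k < d)%nat -> 0 < g k).
  { intros k Hk. specialize (Hs k Hk). apply Rmult_lt_0_compat; [apply pow_lt; lra|auto]. }
  rewrite pow_mult, (one_plus_pow_odd_factor d _ Hw : 1 + (tan t ^ 2) ^ m = _). fold m.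
  assert (Hfac : forall k, (k < d)%nat ->
    (tan t ^ 2) ^ 2 - 2 * phi m k * tan t ^ 2 + 1 = q ^ 2 * g k).
  { intros k Hk. apply quadratic_tan_factor; [exact Ht|apply Hs, Hk|].
    apply pow2_sqrt. assert (H := phi_lt_1 d k Hk). fold m in H. lra. }
  rewrite Hq1, ln_mult, ln_prod_lt, Hlnq; [|intros k Hk; rewrite Hfac..|exact Hq|
     apply prod_lt_pos; intros k Hk; rewrite Hfac]; auto;
    try (apply Rmult_lt_0_compat; [apply pow_lt, Hq|auto]).
  rewrite (sum_lt_ext _ (fun k => 2 * ln q + 
     (2 * ln ((1 + s k) / 2) + ln (1 + 2 * r k * cos (4 * t) + r k ^ 2)))).
  - rewrite sum_lt_plus_const, Hlnq. unfold m. rewrite plus_INR, mult_INR. simpl INR. ring.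
  - intros k Hk. specialize (Hs k Hk).
    rewrite Hfac by exact Hk. unfold g.
    rewrite !ln_mult; try apply pow_lt; auto; try lra.
    2: { apply Rmult_lt_0_compat; [apply pow_lt; lra|auto]. }
    rewrite !ln_pow by lra. simpl INR. ring.
Qed.

Lemma is_RInt_ln_one_plus_tan_pow (d : nat) :
  let m := (2 * d + 1)%nat in
  is_RInt (fun t => ln (1 + tan t ^ (2 * m))) 0 (PI / 4)
    ((INR m + 1) * PI / 4 * ln 2 - INR m * catalan
     + PI / 2 * sum_lt (fun k => ln (1 + sqrt ((1 - phi m k) / 2))) d).
Proof.
  intros m. assert (Hpi := PI_RGT_0).
  set (s := fun k => sqrt ((1 - phi m k) / 2)).
  set (r := fun k => (1 - s k) / (1 + s k)).
  assert (Hs : forall k, (k < d)%nat -> 0 < s k <= 1).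
  { intros k Hk. apply half_angle_sine_bounds.
    split; [apply COS_bound|now apply phi_lt_1]. }
  assert (Hr : forall k, (k < d)%nat -> 0 <= r k < 1).
  { intros k Hk. specialize (Hs k Hk).
    split; [apply Rdiv_le_0_compat; lra|].
    unfold r. apply (Rmult_lt_reg_r (1 + s k)); [lra|].
    replace ((1 - s k) / (1 + s k) * (1 + s k)) with (1 - s k) by (field; lra). lra. }
  apply (is_RInt_ext (fun t => INR m * (2 * ln 2 - ln (2 + 2 * cos (2 * t))) +
    sum_lt (fun k => 2 * ln ((1 + s k) / 2)
                     + ln (1 + 2 * r k * cos (4 * t) + r k ^ 2)) d)).
  (* Equality on the open interval suffices; this avoids t = 0, where 1/w is meaningless. *)
  { intros t Ht. rewrite Rmin_left, Rmax_right in Ht by lra.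
    symmetry. now apply ln_one_plus_tan_pow. }
  replace (_ + _) with
    (INR m * ((PI / 4 - 0) * (2 * ln 2) - catalan) +
     sum_lt (fun k => (PI / 4 - 0) * (2 * ln ((1 + s k) / 2)) + 0) d).
  - apply (is_RInt_plus (V := R_NormedModule)
      (fun t => INR m * (2 * ln 2 - ln (2 + 2 * cos (2 * t))))).
    + apply (is_RInt_scal (V := R_NormedModule)
        (fun t => 2 * ln 2 - ln (2 + 2 * cos (2 * t)))).
      apply (is_RInt_minus (V := R_NormedModule) (fun _ => 2 * ln 2));
        [apply (is_RInt_const (V := R_NormedModule))|apply is_RInt_log_catalan].
    + apply (is_RInt_sum_lt (fun k t => 2 * ln ((1 + s k) / 2)
                     + ln (1 + 2 * r k * cos (4 * t) + r k ^ 2))).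
      intros k Hk.
      apply (is_RInt_plus (V := R_NormedModule) (fun _ => 2 * ln ((1 + s k) / 2)));
        [apply (is_RInt_const (V := R_NormedModule))|apply is_RInt_log_poisson; auto].
  (* The coefficient of ln 2 is (m - d) PI/2 = (m + 1) PI/4. *)
  - rewrite (sum_lt_ext _ (fun k => - (PI / 2 * ln 2) + PI / 2 * ln (1 + s k))).
    + rewrite sum_lt_plus_const, sum_lt_scal.
      replace (INR m) with (2 * INR d + 1)
        by (unfold m; rewrite plus_INR, mult_INR; simpl; ring).
      unfold s. field.
    + intros k Hk. specialize (Hs k Hk). rewrite ln_div by lra. field.
Qed.

(** * The inner sum as an integral of powers of the tangent *)

Lemma alternating_geometric_sum_odd (x : R) (m : nat) :
  Nat.Odd m ->
  (1 + x ^ 2) * sum_lt (fun j => (-1) ^ j * x ^ (2 * j)) m = 1 + x ^ (2 * m).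
Proof.
  intros [d ->].
  assert (H : forall n, (1 + x ^ 2) * sum_lt (fun j => (-1) ^ j * x ^ (2 * j)) n
                = 1 - (-1) ^ n * x ^ (2 * n)).
  { induction n as [|n IH]; [simpl; ring|].
    rewrite sum_lt_S, Rmult_plus_distr_l, IH.
    replace (2 * S n)%nat with (2 + 2 * n)%nat by lia.
    rewrite pow_add. replace ((-1) ^ S n) with (- (-1) ^ n) by (simpl; ring). ring. }
  rewrite H. replace (2 * d + 1)%nat with (S (2 * d)) by lia.
  rewrite pow_1_odd. ring.
Qed.

(** Substitution u = tan t, whose derivative is 1 + tan^2 t. *)
Lemma is_RInt_tan_pow (p : nat) :
  is_RInt (fun t => tan t ^ p * (1 + tan t ^ 2)) 0 (PI / 4) (/ INR (S p)).
Proof.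
  assert (Hpi := PI_RGT_0).
  assert (Hp : INR (S p) <> 0) by (apply not_0_INR; lia).
  assert (Hd : forall x, 0 <= x <= PI / 4 -> is_derive tan x (tan x ^ 2 + 1)).
  { intros x Hx. apply is_derive_tan, Rgt_not_eq, cos_gt_0; lra. }
  set (F := fun t => tan t ^ S p / INR (S p)).
  replace (/ INR (S p)) with (minus (F (PI / 4)) (F 0)).
  2: { unfold F, minus, plus, opp. cbn -[INR pow].
       rewrite tan_PI4, tan_0, pow1, pow_i by lia. field. exact Hp. }
  apply (is_RInt_derive F).
  - intros x Hx. rewrite Rmin_left, Rmax_right in Hx by lra. specialize (Hd x Hx).
    unfold F.
    replace (tan x ^ p * (1 + tan x ^ 2))
      with (/ INR (S p) * (INR (S p) * (tan x ^ 2 + 1) * tan x ^ pred (S p))).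
    + apply (is_derive_ext (fun t => / INR (S p) * tan t ^ S p)).
      { intros t. unfold Rdiv; apply Rmult_comm. }
      apply is_derive_scal, is_derive_pow, Hd.
    + cbn [pred]. field. exact Hp.
  - intros x Hx. rewrite Rmin_left, Rmax_right in Hx by lra. specialize (Hd x Hx).
    apply (ex_derive_continuous (V := R_NormedModule)).
    auto_derive. split; [|split; [|trivial]]; now exists (tan x ^ 2 + 1).
Qed.

(** For odd m, 1 + tan^(2m) t is 1 + tan^2 t times an alternating sum of even powers, so each
    summand is integrated by the substitution above. *)
Lemma is_RInt_tan_pow_odd (m n : nat) :
  Nat.Odd m ->
  is_RInt (fun t => (tan t ^ (2 * m)) ^ n * (1 + tan t ^ (2 * m))) 0 (PI / 4)
    (sum_lt (fun j => (-1) ^ j / (2 * INR m * INR n + 2 * INR j + 1)) m).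
Proof.
  intros Hm.
  apply (is_RInt_ext (fun t => sum_lt (fun j => (-1) ^ j *
    (tan t ^ (2 * m * n + 2 * j) * (1 + tan t ^ 2))) m)).
  - intros t _. rewrite <- (alternating_geometric_sum_odd (tan t) m Hm).
    rewrite <- pow_mult.
    rewrite (sum_lt_ext _ (fun j => tan t ^ (2 * m * n) * (1 + tan t ^ 2) *
                                    ((-1) ^ j * tan t ^ (2 * j)))).
    + rewrite sum_lt_scal. apply Rmult_assoc.
    + intros j _. rewrite pow_add. ring.
  - apply (is_RInt_sum_lt (fun j t => (-1) ^ j *
      (tan t ^ (2 * m * n + 2 * j) * (1 + tan t ^ 2)))).
    intros j _.
    replace (2 * INR m * INR n + 2 * INR j + 1) with (INR (S (2 * m * n + 2 * j)))
      by (rewrite S_INR, plus_INR, !mult_INR; simpl; ring).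
    apply (is_RInt_scal (V := R_NormedModule)), is_RInt_tan_pow.
Qed.

(** * Harmonic partial sums and passage to the limit *)

Lemma harmonic_S (n : nat) : harmonic (S n) = harmonic n + / INR (S n).
Proof. unfold harmonic. rewrite sum_lt_S. now rewrite Nat.add_1_r. Qed.

(** Telescopes 1/(n+1) <= 2 (sqrt (n+1) - sqrt n). Any growth of smaller order than n would make the
    boundary term vanish after integration. *)
Lemma harmonic_bounds (n : nat) : 0 <= harmonic n <= 2 * sqrt (INR n).
Proof.
  induction n as [|n IH].
  - change (harmonic 0) with 0. simpl INR. rewrite sqrt_0. lra.
  - rewrite harmonic_S. assert (Hn := pos_INR n).
    assert (HS : 0 < INR (S n)) by (rewrite S_INR; lra).
    assert (Hi : 0 < / INR (S n)) by now apply Rinv_0_lt_compat.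
    split; [lra|].
    set (a := sqrt (INR n)) in *. set (b := sqrt (INR (S n))).
    assert (Ha : a * a = INR n) by (apply sqrt_sqrt; lra).
    assert (Hb : b * b = INR (S n)) by (apply sqrt_sqrt; lra).
    assert (Ha0 : 0 <= a) by apply sqrt_pos.
    assert (Hb0 : 0 < b) by now apply sqrt_lt_R0.
    assert (Hab : b * b = a * a + 1) by (rewrite Ha, Hb; apply S_INR).
    rewrite <- Hb. enough (/ (b * b) <= 2 * (b - a)) by (rewrite <- Hb in *; lra).
    assert (a <= b) by nra.
    assert (1 <= b) by nra.
    (* Since (b - a) (b + a) = 1, this says 1 <= 2 (b - a) b^2. *)
    assert (0 <= (b - a) * (2 * (b * b) - (a + b))) by (apply Rmult_le_pos; nra).
    apply (Rmult_le_reg_r (b * b)); [lra|].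
    rewrite Rinv_l by lra. lra.
Qed.

(* Summation by parts against [H_n - H_(n-1) = 1/n]. *)
Lemma harmonic_partial_sum (y : R) (N : nat) :
  sum_lt (fun i => (-1) ^ (i + 1 + 1) * harmonic (i + 1) * (y ^ (i + 1) * (1 + y))) N =
  / 2 * log_kernel_partial N y 0 + (-1) ^ S N * harmonic N * y ^ S N.
Proof.
  induction N as [|N IH].
  - change (harmonic 0) with 0. unfold log_kernel_partial. simpl. ring.
  - rewrite sum_lt_S, IH. unfold log_kernel_partial.
    (* At angle 0 every cosine is 1, so half the kernel sum is the Taylor polynomial of ln (1 +
       y). *)
    rewrite sum_lt_S, Rmult_0_r, cos_0, !Nat.add_1_r, harmonic_S.
    simpl pow. field. apply not_0_INR; lia.
Qed.

(** The Taylor remainder and the boundary term each contribute at most 2 sqrt (N+1) y^(N+1). *)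
Lemma harmonic_partial_sum_remainder (y : R) (N : nat) :
  0 <= y <= 1 ->
  Rabs (sum_lt (fun i => (-1) ^ (i + 1 + 1) * harmonic (i + 1) * (y ^ (i + 1) * (1 + y))) N
        - ln (1 + y)) <= 4 * sqrt (INR (S N)) * y ^ S N.
Proof.
  intros Hy. rewrite harmonic_partial_sum.
  assert (HN := pos_INR N).
  assert (HK : Rabs (ln (1 + 2 * y * cos 0 + y ^ 2) - log_kernel_partial N y 0)
               <= 4 / 1 * y ^ S N / INR (S N)).
  { apply log_kernel_remainder; try lra. intros x Hx. rewrite cos_0. nra. }
  (* At angle 0 the kernel is a square, so its logarithm is 2 ln (1 + y). *)
  replace (1 + 2 * y * cos 0 + y ^ 2) with ((1 + y) * (1 + y)) in HK
    by (rewrite cos_0; ring).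
  rewrite ln_mult in HK by lra.
  assert (Hp : 0 <= y ^ S N) by (apply pow_le; lra).
  assert (Hs : 1 <= sqrt (INR (S N))).
  { rewrite <- sqrt_1. apply sqrt_le_1; try lra; rewrite S_INR; lra. }
  assert (H1 : Rabs (/ 2 * log_kernel_partial N y 0 - ln (1 + y)) <= 2 * y ^ S N).
  { replace (_ - _) with (- / 2 * (ln (1 + y) + ln (1 + y) - log_kernel_partial N y 0)) by field.
    rewrite Rabs_mult, Rabs_left by lra.
    assert (4 / 1 * y ^ S N / INR (S N) <= 4 * y ^ S N); [|lra].
    replace (4 * y ^ S N) with (4 / 1 * y ^ S N / 1) by field.
    apply Rmult_le_compat_l; [lra|]. apply Rinv_le_contravar; [lra|rewrite S_INR; lra]. }
  assert (H2 : Rabs ((-1) ^ S N * harmonic N * y ^ S N) <= 2 * sqrt (INR (S N)) * y ^ S N).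
  { assert (HH := harmonic_bounds N).
    rewrite !Rabs_mult, pow_1_abs, Rabs_pos_eq, (Rabs_pos_eq (y ^ S N)), Rmult_1_l by lra.
    apply Rmult_le_compat_r; [exact Hp|].
    assert (sqrt (INR N) <= sqrt (INR (S N))) by (apply sqrt_le_1; rewrite ?S_INR; lra).
    lra. }
  assert (2 * y ^ S N <= 2 * sqrt (INR (S N)) * y ^ S N) by nra.
  replace (_ - ln (1 + y)) with
    ((/ 2 * log_kernel_partial N y 0 - ln (1 + y)) + (-1) ^ S N * harmonic N * y ^ S N) by ring.
  eapply Rle_trans; [apply Rabs_triang|]. lra.
Qed.

(** The pointwise bound grows at t = PI/4, but its integral is at most 4 sqrt (N+1) / (2m(N+1) + 1),
    hence at most 4 / sqrt (N+1). *)
Lemma is_lim_seq_sum_term (m : nat) (L : R) :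
  Nat.Odd m ->
  is_RInt (fun t => ln (1 + tan t ^ (2 * m))) 0 (PI / 4) L ->
  is_lim_seq (sum_lt (fun i => term m (i + 1))) L.
Proof.
  intros Hm HL. assert (Hpi := PI_RGT_0).
  apply (is_lim_seq_le_inv_sqrt _ _ 4). intros N.
  assert (HS : is_RInt (fun t => sum_lt (fun i => (-1) ^ (i + 1 + 1) * harmonic (i + 1) *
      ((tan t ^ (2 * m)) ^ (i + 1) * (1 + tan t ^ (2 * m)))) N)
      0 (PI / 4) (sum_lt (fun i => term m (i + 1)) N)).
  { apply (is_RInt_sum_lt (fun i t => (-1) ^ (i + 1 + 1) * harmonic (i + 1) *
      ((tan t ^ (2 * m)) ^ (i + 1) * (1 + tan t ^ (2 * m))))).
    intros i _. apply (is_RInt_scal (V := R_NormedModule)), is_RInt_tan_pow_odd, Hm. }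
  (* The majorant carries an extra factor 1 + tan^2 t >= 1 to make its integral explicit. *)
  assert (HB := is_RInt_scal (V := R_NormedModule) _ _ _ (4 * sqrt (INR (S N))) _
                  (is_RInt_tan_pow (2 * m * S N))).
  assert (HN : 0 < INR (S N)) by (apply lt_0_INR; lia).
  assert (Hsq : 0 < sqrt (INR (S N))) by now apply sqrt_lt_R0.
  apply Rle_trans with (4 * sqrt (INR (S N)) * / INR (S (2 * m * S N))).
  - refine (norm_RInt_le (V := R_NormedModule) _ _ 0 (PI / 4) _ _ _ _
              (is_RInt_minus _ _ _ _ _ _ HS HL) HB); [lra|].
    intros t Ht.
    assert (Ht0 : 0 <= tan t) by (rewrite <- tan_0; apply tan_incr_1; lra).
    assert (Ht1 : tan t <= 1) by (rewrite <- tan_PI4; apply tan_incr_1; lra).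
    eapply Rle_trans; [apply harmonic_partial_sum_remainder|].
    + split; [now apply pow_le|]. rewrite <- (pow1 (2 * m)). now apply pow_incr.
    + change (scal ?a ?b) with (a * b). rewrite <- pow_mult.
      assert (0 <= tan t ^ (2 * m * S N)) by now apply pow_le.
      apply Rmult_le_compat_l; [lra|]. assert (0 <= tan t ^ 2) by now apply pow_le.
      nra.
  - apply Rle_trans with (4 * sqrt (INR (S N)) * / INR (S N)).
    + apply Rmult_le_compat_l; [lra|]. apply Rinv_le_contravar; [exact HN|].
      apply le_INR. destruct Hm as [d ->]. nia.
    + right. rewrite <- (sqrt_sqrt (INR (S N))) at 2 by lra. field. lra.
Qed.

(* [is_series] asserts that the partial sums converge to the given value; the
   index n = i + 1 starts at 1.  The range 0 <= k <= (m-3)/2 has (m-1)/2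
   elements (none when m = 1). *)
Theorem theorem3p1 (m : nat) (hm : (1 <= m)%nat) (hodd : Nat.Odd m) :
  is_series (fun i : nat => term m (i + 1))
    ((INR m + 1) * PI / 4 * ln 2 - INR m * catalan
     + PI / 2 * sum_lt (fun k => ln (1 + sqrt ((1 - phi m k) / 2)))
                       ((m - 1) / 2)%nat).
Proof.
  destruct (hodd) as [d Hd].
  replace ((m - 1) / 2)%nat with d
    by (rewrite Hd, Nat.add_sub, Nat.mul_comm, Nat.div_mul; lia).
  match goal with |- is_series ?a ?l => change (is_lim_seq (sum_n a) l) end.
  apply (is_lim_seq_ext (fun n => sum_lt (fun i => term m (i + 1)) (S n))).
  { intros n. now rewrite sum_n_sum_lt. }
  (* [sum_n] up to n has n+1 terms; the shift does not affect the limit. *)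
  apply (is_lim_seq_incr_1 (sum_lt (fun i => term m (i + 1)))).
  apply is_lim_seq_sum_term; [exact hodd|].
  rewrite Hd. apply is_RInt_ln_one_plus_tan_pow.
Qed.
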